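(* If $\mathcal{C}$ is a complete admissible uniform clutter, then the simplicial complex generated by the edges of $\mathcal{C}$ is pure shellable.
   Context: A clutter $\mathcal{C}$ with finite vertex set $X$ is a family $E(\mathcal{C})$ of subsets of $X$, called edges, none of which is included in another. The edge ideal $I(\mathcal{C})$ is the ideal of the polynomial ring $K[X]$ over a field $K$ generated by the monomials $\prod_{x\in e}x$, $e\in E(\mathcal{C})$; its height equals the minimum size of a vertex cover (a subset of $X$ meeting every edge). A perfect matching of $\mathcal{C}$ is a set of pairwise disjoint edges whose union is $X$. Given two partitions $X^1,\ldots,X^d$ and $e_1,\ldots,e_g$ of $X$ with $|e_i\cap X^j|\leq 1$ for all $i,j$, a subset $e\subset X$ of size $k\geq 1$ is called admissible if $e=\{x_1,\ldots,x_k\}$ with $x_i\in X^i\cap e_{j_i}$ for $i=1,\ldots,k$ and $j_1\leq\cdots\leq j_k$. $\mathcal{C}$ is a complete admissible uniform clutter if it has a perfect matching $e_1,\ldots,e_g$, where $g$ is the height of $I(\mathcal{C})$, and there is a partition $X^1,\ldots,X^d$ of $X$ such that every edge of $\mathcal{C}$ intersects each $X^i$ in exactly one vertex, every inclusion-maximal admissible subset of $X$ is an edge of $\mathcal{C}$, and these are the only edges of $\mathcal{C}$. (Thus, writing $x^i_j$ for the unique element of $X^i\cap e_j$, the edges of $\mathcal{C}$ are exactly the sets $\{x^1_{j_1},x^2_{j_2},\ldots,x^d_{j_d}\}$ with $1\leq j_1\leq j_2\leq\cdots\leq j_d\leq g$.) The simplicial complex generated by the edges is the one whose facets are the edges of $\mathcal{C}$.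 A simplicial complex $\Delta$ is shellable if its facets can be ordered $F_1,\ldots,F_s$ such that for all $1\leq i<j\leq s$ there exist $v\in F_j\setminus F_i$ and $\ell\in\{1,\ldots,j-1\}$ with $F_j\setminus F_\ell=\{v\}$. It is pure if all its facets have the same dimension, and pure shellable if it is both pure and shellable. *)

(* Defs.v *)
From HB Require Import structures.
From mathcomp Require Import all_boot all_order all_algebra.
From mathcomp Require Import mpoly.

Set Implicit Arguments.
Unset Strict Implicit.
Unset Printing Implicit Defensive.

Import GRing.Theory.

Local Open Scope ring_scope.

Section Height.

Variable R : comNzRingType.

(* [idealr_closed] includes properness ([1 \notin P]); classically, boolean
   predicates are arbitrary subsets. *)
Definition prime_ideal (P : {pred R}) : Prop :=
  idealr_closed P /\ prime_idealr_closed P.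

(* There is a chain P_0 < P_1 < ... < P_n = P of prime ideals. *)
Definition prime_height_ge (P : {pred R}) (n : nat) : Prop :=
  exists Q : nat -> {pred R},
    [/\ forall i, (i <= n)%N -> prime_ideal (Q i),
        Q n =i P &
        forall i, (i < n)%N ->
          {subset Q i <= Q i.+1} /\ exists2 a, a \in Q i.+1 & a \notin Q i].

(* The minimum of the heights of the prime ideals containing I; the unit ideal
   lies in no prime ideal, and no natural number is its height. *)
Definition ideal_height (I : R -> Prop) (n : nat) : Prop :=
  (forall P, prime_ideal P -> (forall a, I a -> a \in P) ->
     prime_height_ge P n) /\
  (exists P, [/\ prime_ideal P, forall a, I a -> a \in P &
     ~ prime_height_ge P n.+1]).

End Height.

Section Clutters.

Variable X : finType.

Record clutter := Clutter {
  edges :> {set {set X}};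
  edges_incomparable :
    forall A B : {set X}, A \in edges -> B \in edges -> A \subset B -> A = B }.

Definition edge_ideal (K : fieldType) (C : clutter) (p : {mpoly K[#|X|]}) : Prop :=
  exists c : {set X} -> {mpoly K[#|X|]},
    p = \sum_(A in edges C) c A * \prod_(x in A) 'X_(enum_rank x).

Definition perfect_matching (C : clutter) (M : {set {set X}}) : Prop :=
  [/\ M \subset edges C, trivIset M & cover M = [set: X]].

Definition ordered_partition (d : nat) (V : 'I_d -> {set X}) : Prop :=
  injective V /\ partition [set V i | i : 'I_d] [set: X].

Definition admissible (d g : nat) (V : 'I_d -> {set X}) (e : 'I_g -> {set X})
    (A : {set X}) : Prop :=
  exists (k : nat) (le_kd : (k <= d)%N) (x : 'I_k -> X) (j : 'I_k -> 'I_g),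
    [/\ (0 < k)%N /\ #|A| = k,
        A = [set x i | i : 'I_k],
        forall i, x i \in V (widen_ord le_kd i) :&: e (j i) &
        forall i i' : 'I_k, (i <= i')%N -> (j i <= j i')%N].

Definition maximal_admissible (d g : nat) (V : 'I_d -> {set X})
    (e : 'I_g -> {set X}) (A : {set X}) : Prop :=
  admissible V e A /\ forall B, admissible V e B -> A \subset B -> B = A.

Definition complete_admissible_uniform (K : fieldType) (C : clutter) : Prop :=
  exists (g d : nat) (e : 'I_g -> {set X}) (V : 'I_d -> {set X}),
    [/\ ideal_height (@edge_ideal K C) g,
        injective e /\ perfect_matching C [set e i | i : 'I_g],
        ordered_partition V,
        forall A, A \in edges C -> forall i, #|A :&: V i| = 1%N &
        forall A, A \in edges C <-> maximal_admissible V e A].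

Record simplicial_complex := SimplicialComplex {
  faces :> {set {set X}};
  faces_closed : forall F G : {set X}, F \in faces -> G \subset F -> G \in faces }.

Definition facets (D : simplicial_complex) : {set {set X}} :=
  [set F : {set X} | maxset (fun G => G \in faces D) F].

Definition generated_faces (S : {set {set X}}) : {set {set X}} :=
  [set F : {set X} | [exists A in S, F \subset A]].

Lemma generated_faces_closed (S : {set {set X}}) (F G : {set X}) :
  F \in generated_faces S -> G \subset F -> G \in generated_faces S.
Proof.
rewrite !inE => /exists_inP [A AS FA] GF.
by apply/exists_inP; exists A => //; apply: subset_trans FA.
Qed.

Definition generated_complex (S : {set {set X}}) : simplicial_complex :=
  SimplicialComplex (@generated_faces_closed S).

Definition face_dim (F : {set X}) : int := #|F|%:Z - 1.

Definition pure (D : simplicial_complex) : Prop :=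
  forall F G, F \in facets D -> G \in facets D -> face_dim F = face_dim G.

Definition shellable (D : simplicial_complex) : Prop :=
  exists s : seq {set X},
    [/\ uniq s, s =i facets D &
        forall i j, (i < j < size s)%N ->
          exists v l, [/\ v \in nth set0 s j :\: nth set0 s i, (l < j)%N &
                          nth set0 s j :\: nth set0 s l = [set v]]].

Definition pure_shellable (D : simplicial_complex) : Prop :=
  pure D /\ shellable D.

End Clutters.

(* Main.v *)
Require Import Defs.
From HB Require Import structures.
From mathcomp Require Import all_boot all_order all_algebra.
From mathcomp Require Import mpoly.

Set Implicit Arguments.
Unset Strict Implicit.
Unset Printing Implicit Defensive.

(** Write [x i j] for the only vertex of [V i :&: e j].  An edge meets every
    [V i], so it has [d] vertices and, being admissible, it is the graph
    [{x i (f i)}] of a nondecreasing [f : 'I_d -> 'I_g]; conversely such a graph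
    is admissible of the largest possible size, hence an edge
    ([edge_transversal]).  Purity is then immediate.

    The facets are shelled by increasing weight [\sum_i f i], ties being broken
    arbitrarily.  Let [h] come before [f], with [h] different from [f].  As the
    weight of [h] is at most that of [f], [h p < f p] for some [p]; take the
    least one.  Then [f (p - 1) <= h (p - 1) <= h p < f p], so lowering the value
    of [f] at [p] to [h p] keeps it nondecreasing.  The resulting graph has
    smaller weight, and misses from the graph of [f] only the vertex
    [x p (f p)], which is not on the graph of [h] either
    ([transversal_exchange]). *)

(** * Facets and shellings by weight *)

Section Facets.

Variable X : finType.

Lemma facets_generated_clutter (C : clutter X) :
  facets (generated_complex (edges C)) = edges C.
Proof.
apply/setP => F; rewrite inE; apply/idP/idP.
  case/maxsetP; rewrite inE => /exists_inP[A A_in FA] maxF.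
  suff <- : A = F by [].
  by apply: maxF FA; rewrite inE; apply/exists_inP; exists A.
move=> FC; apply/maxsetP; split; first by rewrite inE; apply/exists_inP; exists F.
move=> G; rewrite inE => /exists_inP[A A_in GA] FG.
have FA : F = A by apply: (edges_incomparable FC A_in); apply: subset_trans GA.
by apply/eqP; rewrite eqEsubset FG FA GA.
Qed.

(** Asking the exchange only for a facet of strictly smaller weight makes any
    ordering by nondecreasing weight a shelling, however ties are broken. *)
Lemma shellable_of_weight (D : simplicial_complex X) (w : {set X} -> nat) :
  (forall A B, A \in facets D -> B \in facets D -> A != B -> w A <= w B ->
     exists v L, [/\ v \in B :\: A, L \in facets D, w L < w B &
                     B :\: L = [set v]]) ->
  shellable D.
Proof.
move=> exchange; pose r := relpre w leq.
have r_trans : transitive r by move=> A B C; apply: leq_trans.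
have r_total : total r by move=> A B; apply: leq_total.
pose s := sort r (enum (facets D)).
have mem_s : s =i facets D by move=> A; rewrite mem_sort mem_enum.
have uniq_s : uniq s by rewrite sort_uniq enum_uniq.
have le_s i j : i <= j < size s -> w (nth set0 s i) <= w (nth set0 s j).
  case/andP=> ij js.
  apply: (sorted_leq_nth r_trans _ set0 (sort_sorted r_total _)) => //.
  - by move=> A; rewrite /r /=.
  - exact: leq_ltn_trans js.
exists s; split=> // i j /andP[ij js].
have si : i < size s by apply: ltn_trans js.
have [||||v [L [vBA LD wL BL]]] := exchange (nth set0 s i) (nth set0 s j).
- by rewrite -mem_s mem_nth.
- by rewrite -mem_s mem_nth.
- by rewrite nth_uniq // neq_ltn ij.
- by apply: le_s; rewrite (ltnW ij).
have Ls : L \in s by rewrite mem_s.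
exists v, (index L s); split=> //; last by rewrite nth_index.
rewrite ltnNge; apply: contraL wL => jL.
by rewrite -leqNgt -[leqRHS](congr1 w (nth_index set0 Ls)) le_s // jL index_mem.
Qed.

End Facets.

(** * Transversals of nondecreasing functions *)

Section Transversals.

Variables (X : finType) (d g : nat) (x : 'I_d -> 'I_g -> X).

Hypothesis x_inj : forall i i' j j', x i j = x i' j' -> i = i' /\ j = j'.

Definition nondecreasing (f : 'I_d -> 'I_g) : Prop :=
  forall i i' : 'I_d, i <= i' -> f i <= f i'.

Definition transversal (f : 'I_d -> 'I_g) : {set X} := [set x i (f i) | i : 'I_d].

(** On a transversal this is the sum of the values of the function
    ([weight_transversal]); defining it on all sets avoids recovering the
    function from its transversal. *)
Definition weight (A : {set X}) : nat :=
  \sum_(i < d) \sum_(j < g | x i j \in A) j.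

Lemma mem_transversal f i j : (x i j \in transversal f) = (j == f i).
Proof.
apply/imsetP/eqP => [[k _ /x_inj[-> ->]]|->] //.
by exists i.
Qed.

Lemma card_transversal f : #|transversal f| = d.
Proof. by rewrite card_imset ?card_ord // => i i' /x_inj[]. Qed.

Lemma weight_transversal f : weight (transversal f) = \sum_(i < d) f i.
Proof.
by apply: eq_bigr => i _; apply: big_pred1 => j; rewrite mem_transversal.
Qed.

Lemma exists_lt_of_sum_le (f h : 'I_d -> 'I_g) :
  transversal h != transversal f -> \sum_(i < d) h i <= \sum_(i < d) f i ->
  exists i, h i < f i.
Proof.
move=> neq_hf le_hf; apply/existsP; apply: contraNT neq_hf.
rewrite negb_exists => /forallP fh.
have le_fh i : f i <= h i by rewrite leqNgt.
have /forallP eq_fh : [forall (i | true), f i == h i :> nat].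
  rewrite -(leqif_sum (fun i _ => leqif_eq (le_fh i))) eqn_leq le_hf andbT.
  exact: leq_sum.
apply/eqP/eq_imset => i; congr (x i _).
by apply: val_inj; have /eqP := eq_fh i.
Qed.

(** The first place where [h] is below [f] is the one where [f] can be lowered
    to [h] without losing monotonicity. *)
Lemma transversal_exchange (f h : 'I_d -> 'I_g) :
  nondecreasing f -> nondecreasing h -> transversal h != transversal f ->
  weight (transversal h) <= weight (transversal f) ->
  exists v f',
    [/\ v \in transversal f :\: transversal h, nondecreasing f',
        weight (transversal f') < weight (transversal f) &
        transversal f :\: transversal f' = [set v]].
Proof.
move=> f_mono h_mono neq_hf; rewrite !weight_transversal => le_hf.
have [p0 hf0] := exists_lt_of_sum_le neq_hf le_hf.
have [p hfp p_min] := @arg_minnP _ p0 (fun i => h i < f i) val hf0.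
pose f' i := if i == p then h p else f i.
have f'_off i : i != p -> f' i = f i by rewrite /f' => /negbTE->.
have f'_on : f' p = h p by rewrite /f' eqxx.
exists (x p (f p)), f'; split.
- by rewrite inE !mem_transversal eqxx andbT neq_ltn hfp orbT.
- move=> i i' le_ii'; have [eq_i|ne_i] := eqVneq i p.
    have [eq_i'|ne_i'] := eqVneq i' p; first by rewrite eq_i eq_i'.
    rewrite (f'_off _ ne_i') eq_i f'_on (leq_trans (ltnW hfp)) //.
    by apply: f_mono; rewrite -eq_i.
  rewrite (f'_off _ ne_i); have [eq_i'|ne_i'] := eqVneq i' p; last first.
    by rewrite (f'_off _ ne_i') f_mono.
  (* Minimality of [p] gives [f i <= h i] at this [i < p]. *)
  have lt_ip : i < p by rewrite ltn_neqAle ne_i -eq_i'.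
  rewrite eq_i' f'_on (leq_trans _ (h_mono _ _ (ltnW lt_ip))) // leqNgt.
  by apply: contraL lt_ip => /p_min; rewrite -leqNgt.
- rewrite weight_transversal (bigD1 p) //= [ltnRHS](bigD1 p) //= f'_on.
  by rewrite (eq_bigr (fun i => f i : nat)) ?ltn_add2r // => i /f'_off->.
apply/setP => y; rewrite !inE; apply/andP/eqP => [[yf' /imsetP[i _ y_i]]|->].
  move: yf'; rewrite y_i mem_transversal; have [->//|ne_ip] := eqVneq i p.
  by rewrite f'_off ?eqxx.
by rewrite !mem_transversal f'_on eqxx neq_ltn hfp orbT.
Qed.

Lemma pure_shellable_transversals (C : clutter X) :
  (forall A, A \in edges C <->
     exists2 f, nondecreasing f & A = transversal f) ->
  pure_shellable (generated_complex (edges C)).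
Proof.
move=> edgeP; split.
  move=> A B; rewrite facets_generated_clutter.
  move=> /edgeP[f _ ->] /edgeP[h _ ->].
  by rewrite /face_dim !card_transversal.
apply: (@shellable_of_weight _ _ weight) => A B.
rewrite facets_generated_clutter => /edgeP[h h_mono ->] /edgeP[f f_mono ->].
move=> neq_hf le_hf.
have [v [f' [vf f'_mono lt_f' f_f']]] :=
  transversal_exchange f_mono h_mono neq_hf le_hf.
exists v, (transversal f'); split=> //.
by apply/edgeP; exists f'.
Qed.

End Transversals.

(** * Admissible sets as transversals *)

Section Blocks.

Variable X : finType.

Lemma trivIset_index_inj (n : nat) (B : 'I_n -> {set X}) (i i' : 'I_n) (y : X) :
  injective B -> trivIset [set B k | k : 'I_n] -> y \in B i -> y \in B i' ->
  i = i'.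
Proof.
move=> B_inj /trivIsetP tB yi yi'; apply: B_inj; apply/eqP; apply: contraT.
have B_in k : B k \in [set B k | k : 'I_n] by apply: imset_f.
move/(tB _ _ (B_in i) (B_in i')).
by move/disjoint_setI0/setP/(_ y); rewrite !inE yi yi'.
Qed.

Lemma card_ordered_partition (d : nat) (V : 'I_d -> {set X}) (A : {set X}) :
  ordered_partition V -> (forall i, #|A :&: V i| = 1) -> #|A| = d.
Proof.
case=> V_inj /and3P[/eqP covV triV _] A_V.
have sA : A :&: cover [set V i | i : 'I_d] = A by rewrite covV setIT.
rewrite -sA /cover big_imset /=; last by move=> i i' _ _; apply: V_inj.
rewrite big_distrr /= -sum1_card partition_disjoint_bigcup => [|i i' ne_ii'].
  by under eq_bigr => i _ do rewrite sum1_card A_V; rewrite sum1_card card_ord.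
rewrite -setI_eq0; apply: contraNT ne_ii' => /set0Pn[y].
rewrite !inE => /andP[/andP[_ yi] /andP[_ yi']].
by apply/eqP; apply: trivIset_index_inj yi yi'.
Qed.

Variables (d g : nat) (V : 'I_d -> {set X}) (e : 'I_g -> {set X}).
Variable x : 'I_d -> 'I_g -> X.
Hypothesis x_block : forall i j, V i :&: e j = [set x i j].

Lemma card_admissible_le A : admissible V e A -> #|A| <= d.
Proof. by case=> k [le_kd [y [j [[_ ->]]]]]. Qed.

Lemma admissible_transversal A :
  admissible V e A -> #|A| = d ->
  exists2 f, nondecreasing f & A = transversal x f.
Proof.
case=> k [le_kd [y [f [[_ ->] A_y y_in f_mono]]]] kd; move: le_kd y_in.
rewrite {}A_y; case: d / kd V x x_block => V' x' x'_block le_kk y_in.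
exists f => //; apply: eq_imset => i; apply/set1P; rewrite -x'_block.
by have := y_in i; rewrite (_ : widen_ord le_kk i = i) //; apply: val_inj.
Qed.

Lemma transversal_admissible f :
  0 < d -> #|transversal x f| = d -> nondecreasing f ->
  admissible V e (transversal x f).
Proof.
move=> d_gt0 card_f f_mono.
exists d, (leqnn d), (fun i => x i (f i)), f; split=> // i.
by rewrite (_ : widen_ord _ i = i) ?x_block ?inE //; apply: val_inj.
Qed.

(** Admissible sets have at most [d] elements, so those of size [d] are maximal;
    transversals attain this bound.  Without [0 < d] the equivalence fails: the
    empty set is then a transversal, but it is not admissible. *)
Lemma edge_transversal (C : clutter X) :
  (forall f, #|transversal x f| = d) -> 0 < d ->
  (forall A, A \in edges C -> #|A| = d) ->
  (forall A, A \in edges C <-> maximal_admissible V e A) ->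
  forall A, A \in edges C <-> exists2 f, nondecreasing f & A = transversal x f.
Proof.
move=> card_x d_gt0 card_C edgeP A; split=> [A_in|[f f_mono ->]].
  have [adm_A _] := (edgeP A).1 A_in.
  by apply: admissible_transversal adm_A (card_C A A_in).
apply/edgeP; split; first exact: transversal_admissible.
move=> B adm_B sub_fB; apply/eqP.
by rewrite eq_sym eqEcard sub_fB card_x card_admissible_le.
Qed.

End Blocks.

Theorem theorem3p7 (K : fieldType) (X : finType) (C : clutter X) :
  complete_admissible_uniform K C ->
  pure_shellable (generated_complex (edges C)).
Proof.
move=> [g [d [e [V [_ [e_inj [/subsetP e_C e_triv _]] V_part C_V edgeP]]]]].
have eC j : e j \in edges C by apply: e_C; apply: imset_f.
have block i j : {y | V i :&: e j == [set y]}.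
  apply: sigW; have /eqP/cards1P[y eq_y] := C_V _ (eC j) i.
  by exists y; rewrite setIC eq_y.
pose x i j := sval (block i j).
have x_block i j : V i :&: e j = [set x i j] by apply/eqP; apply: (svalP (block i j)).
have x_in i j : x i j \in V i /\ x i j \in e j.
  by apply/setIP; rewrite x_block set11.
have V_triv : trivIset [set V i | i : 'I_d] by case: V_part => _ /and3P[].
have x_inj i i' j j' : x i j = x i' j' -> i = i' /\ j = j'.
  have [[xV xe] [xV' xe']] := (x_in i j, x_in i' j') => eq_x; split.
    by apply: (trivIset_index_inj V_part.1 V_triv xV); rewrite eq_x.
  by apply: (trivIset_index_inj e_inj e_triv xe); rewrite eq_x.
have card_C A : A \in edges C -> #|A| = d.
  by move=> A_in; apply: card_ordered_partition V_part (C_V A A_in).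
have [d_gt0|d_eq0] := ltnP 0 d.
  apply: (pure_shellable_transversals x_inj).
  apply: (edge_transversal x_block (card_transversal x_inj) d_gt0 card_C).
  exact: edgeP.
(* With no block there is no admissible set, hence no facet. *)
have no_edge A : A \in edges C -> False.
  case/edgeP=> -[k [le_kd [_ [_ [[k_gt0 _] _ _ _]]]]] _.
  by have := leq_trans (leq_trans k_gt0 le_kd) d_eq0.
have no_facet A : A \in facets (generated_complex (edges C)) -> False.
  by rewrite facets_generated_clutter => /no_edge.
split=> [A B /no_facet //|].
exists [::]; split=> // [A|i j]; last by rewrite ltn0 andbF.
by rewrite in_nil; apply/esym/negP => /no_facet.
Qed.
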